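(* For every theory $\Gamma$ and every sentence $\varphi$ of $\mathcal{L}_{3.5}$: $\Gamma\models\varphi$ if and only if $\Gamma\vdash\varphi$.
   Context: Syntax of $\mathcal{L}_{3.5}$. Fix a set $P$ of nouns and a set $R$ of verbs. Terms: every noun $p\in P$ is a term; if $r\in R$ and $x$ is a term then $(r\ \mathsf{all}\ x)$ and $(r\ \mathsf{some}\ x)$ are terms. Sentences: $(\mathsf{all}\ x\ y)$ and $(\mathsf{some}\ x\ y)$ for terms $x,y$. A theory is a set of sentences. Semantics. A model $\mathcal{M}$ is a set $M$ (possibly empty) with $[\![p]\!]\subseteq M$ for $p\in P$ and $[\![r]\!]\subseteq M\times M$ for $r\in R$; $[\![r\ \mathsf{all}\ x]\!]=\{m\in M: m\,[\![r]\!]\,n\text{ for all }n\in[\![x]\!]\}$; $[\![r\ \mathsf{some}\ x]\!]=\{m\in M: m\,[\![r]\!]\,n\text{ for some }n\in[\![x]\!]\}$. $\mathcal{M}\models(\mathsf{all}\ x\ y)$ iff $[\![x]\!]\subseteq[\![y]\!]$; $\mathcal{M}\models(\mathsf{some}\ x\ y)$ iff $[\![x]\!]\cap[\![y]\!]\neq\emptyset$. $\Gamma\models\varphi$ means every model of $\Gamma$ satisfies $\varphi$. Provability $\Gamma\vdash\varphi$ is defined by finite derivations using the following rules (for all terms $x,y,z$, verbs $r$, sentences $\varphi$), with non-withdrawn assumptions in $\Gamma$: infer $(\mathsf{all}\ x\ x)$ from no premises; from $(\mathsf{all}\ x\ y)$, $(\mathsf{all}\ y\ z)$ infer $(\mathsf{all}\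 x\ z)$; from $(\mathsf{all}\ x\ y)$ infer $(\mathsf{all}\ (r\ \mathsf{all}\ y)\ (r\ \mathsf{all}\ x))$; from $(\mathsf{some}\ x\ y)$ infer $(\mathsf{some}\ x\ x)$; from $(\mathsf{some}\ x\ y)$ infer $(\mathsf{some}\ y\ x)$; from $(\mathsf{some}\ x\ y)$, $(\mathsf{all}\ y\ z)$ infer $(\mathsf{some}\ x\ z)$; from $(\mathsf{all}\ x\ y)$ infer $(\mathsf{all}\ (r\ \mathsf{some}\ x)\ (r\ \mathsf{some}\ y))$; from $(\mathsf{some}\ x\ y)$ infer $(\mathsf{all}\ (r\ \mathsf{all}\ x)\ (r\ \mathsf{some}\ y))$; from $(\mathsf{some}\ x\ (r\ \mathsf{some}\ y))$ infer $(\mathsf{some}\ y\ y)$; first cases rule: given a derivation of $\varphi$ from $\Gamma\cup\{(\mathsf{some}\ x\ x)\}$ and a derivation of $\varphi$ from $\Gamma\cup\{(\mathsf{all}\ y\ (r\ \mathsf{all}\ x))\}$, conclude $\varphi$ from $\Gamma$; second cases rule: given a derivation of $\varphi$ from $\Gamma\cup\{(\mathsf{some}\ x\ x)\}$ and a derivation of $\varphi$ from $\Gamma\cup\{(\mathsf{all}\ x\ y)\}$, conclude $\varphi$ from $\Gamma$. (In the cases rules the displayed extra assumptions are withdrawn, zero or more occurrences.) *)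

(* Defs.v *)
From Stdlib Require Export Ensembles Relation_Definitions.

Set Implicit Arguments.

Inductive term (P R : Type) : Type :=
| Noun (p : P)
| VerbAll (r : R) (x : term P R)
| VerbSome (r : R) (x : term P R).

Inductive sentence (P R : Type) : Type :=
| All (x y : term P R)
| Exist (x y : term P R). (* the sentence (some x y); [Some] is taken by [option] *)

Definition theory (P R : Type) : Type := Ensemble (sentence P R).

(* The domain may be empty. *)
Record model (P R : Type) : Type := Model {
  domain : Type;
  noun_interp : P -> Ensemble domain;
  verb_interp : R -> relation domain
}.

Fixpoint interp (P R : Type) (M : model P R) (x : term P R) :
    Ensemble (domain M) :=
  match x with
  | Noun _ p => noun_interp M p
  | VerbAll r y => fun m => forall n, In _ (interp M y) n -> verb_interp M r m n
  | VerbSome r y => fun m => exists n, In _ (interp M y) n /\ verb_interp M r m n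
  end.

Definition satisfies (P R : Type) (M : model P R) (phi : sentence P R) : Prop :=
  match phi with
  | All x y => Included _ (interp M x) (interp M y)
  | Exist x y => Inhabited _ (Intersection _ (interp M x) (interp M y))
  end.

Definition is_model_of (P R : Type) (M : model P R) (Gamma : theory P R) : Prop :=
  forall psi, In _ Gamma psi -> satisfies M psi.

Definition entails (P R : Type) (Gamma : theory P R) (phi : sentence P R) : Prop :=
  forall M : model P R, is_model_of M Gamma -> satisfies M phi.

(* The theory argument is the set of assumptions that a derivation may leave
   open: an assumption withdrawn by a cases rule belongs to the theory of the
   subderivation only, where it can be used any number of times. *)
Inductive provable (P R : Type) (Gamma : theory P R) : sentence P R -> Prop :=
| ProvAssumption phi :
    In _ Gamma phi -> provable Gamma phi
| ProvAllRefl x :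
    provable Gamma (All x x)
| ProvAllTrans x y z :
    provable Gamma (All x y) -> provable Gamma (All y z) ->
    provable Gamma (All x z)
| ProvVerbAllAnti r x y :
    provable Gamma (All x y) ->
    provable Gamma (All (VerbAll r y) (VerbAll r x))
| ProvExistRefl x y :
    provable Gamma (Exist x y) -> provable Gamma (Exist x x)
| ProvExistSym x y :
    provable Gamma (Exist x y) -> provable Gamma (Exist y x)
| ProvExistAll x y z :
    provable Gamma (Exist x y) -> provable Gamma (All y z) ->
    provable Gamma (Exist x z)
| ProvVerbSomeMono r x y :
    provable Gamma (All x y) ->
    provable Gamma (All (VerbSome r x) (VerbSome r y))
| ProvVerbAllSome r x y :
    provable Gamma (Exist x y) ->
    provable Gamma (All (VerbAll r x) (VerbSome r y))
| ProvVerbSomeExist r x y :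
    provable Gamma (Exist x (VerbSome r y)) ->
    provable Gamma (Exist y y)
| ProvCasesVerbAll r x y phi :
    provable (Add _ Gamma (Exist x x)) phi ->
    provable (Add _ Gamma (All y (VerbAll r x))) phi ->
    provable Gamma phi
| ProvCasesAll x y phi :
    provable (Add _ Gamma (Exist x x)) phi ->
    provable (Add _ Gamma (All x y)) phi ->
    provable Gamma phi.

(* Main.v *)
From Stdlib Require Import Classical.
From mathcomp.classical Require classical_sets.
Require Import Defs.

Set Implicit Arguments.

(** Soundness is an induction on derivations; each cases rule is a case split
    on whether its term [x] has an empty interpretation.

    For completeness, suppose that [phi] is not provable from [Gamma]. Provability
    from the union of a directed family of theories is provability from one of its
    members ([provable_directed_union]), so Zorn's lemma gives a theory [D] that
    contains [Gamma] and is maximal among those that do not prove [phi]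
    ([maximal_extension]). By the cases rules, such a [D] treats every term as
    nonempty or as empty: it proves [Exist x x], or else it proves every
    [All x y] and every [All y (VerbAll r x)].

    A theory with this property has a canonical model. Its points are the pairs
    [x], [y] with [Exist x y] provable, and a point belongs to the terms that are
    provably above [x] or above [y]. Each pair occurs in two copies, told apart by
    a boolean. The relation of a verb holds where [VerbAll] sentences require it,
    and besides, from a point below [VerbSome r w], it leads to the copy of the
    pair [w], [w] marked [true]. The unmarked copy of the pair [v], [v] is
    therefore an [r]-successor only because of [VerbAll] sentences, and it keeps
    out of [VerbAll r v] every point that is not provably below that term. This
    yields the truth lemma [canonical_truth], and then the sentences true in the
    canonical model are exactly the provable ones, so that of [D] refutes [phi]. *)

(** * Soundness *)

Lemma satisfies_add (P R : Type) (M : model P R) (G : theory P R)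
    (psi : sentence P R) :
  is_model_of M G -> satisfies M psi -> is_model_of M (Add _ G psi).
Proof.
  intros HG Hpsi chi [chi' H | chi' []]; [exact (HG _ H) | exact Hpsi].
Qed.

Lemma satisfies_exist_self (P R : Type) (M : model P R) (x : term P R) m :
  In _ (interp M x) m -> satisfies M (Exist x x).
Proof. intros H. exists m. split; exact H. Qed.

Lemma soundness (P R : Type) (G : theory P R) (phi : sentence P R) :
  provable G phi -> entails G phi.
Proof.
  induction 1 as
    [ G phi H | G x | G x y z _ IH1 _ IH2 | G r x y _ IH | G x y _ IH
    | G x y _ IH | G x y z _ IH1 _ IH2 | G r x y _ IH | G r x y _ IH
    | G r x y _ IH | G r x y phi _ IH1 _ IH2 | G x y phi _ IH1 _ IH2 ];
    intros M HM.
  - exact (HM _ H).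
  - intros m Hm. exact Hm.
  - intros m Hm. apply (IH2 M HM), (IH1 M HM), Hm.
  - intros m Hm n Hn. apply Hm, (IH M HM), Hn.
  - destruct (IH M HM) as [m [m' Hx Hy]].
    exact (satisfies_exist_self _ _ _ Hx).
  - destruct (IH M HM) as [m [m' Hx Hy]]. exists m'. split; assumption.
  - destruct (IH1 M HM) as [m [m' Hx Hy]].
    exists m'. split; [exact Hx | exact (IH2 M HM _ Hy)].
  - intros m [n [Hn Hr]]. exists n. split; [exact (IH M HM _ Hn) | exact Hr].
  - destruct (IH M HM) as [n [n' Hx Hy]].
    intros m Hm. exists n'. split; [exact Hy | exact (Hm _ Hx)].
  - destruct (IH M HM) as [m [m' Hx [n [Hn Hr]]]].
    exact (satisfies_exist_self _ _ _ Hn).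
  - destruct (classic (satisfies M (Exist x x))) as [Hx | Hx].
    + exact (IH1 M (satisfies_add HM Hx)).
    + apply (IH2 M), satisfies_add; [exact HM |].
      intros m _ n Hn. destruct (Hx (satisfies_exist_self _ _ _ Hn)).
  - destruct (classic (satisfies M (Exist x x))) as [Hx | Hx].
    + exact (IH1 M (satisfies_add HM Hx)).
    + apply (IH2 M), satisfies_add; [exact HM |].
      intros m Hm. destruct (Hx (satisfies_exist_self _ _ _ Hm)).
Qed.

(** * Maximal theories *)

Lemma add_mono (T : Type) (A B : Ensemble T) (a : T) :
  Included _ A B -> Included _ (Add _ A a) (Add _ B a).
Proof.
  intros H b [b' Hb | b' Hb]; [left; exact (H _ Hb) | right; exact Hb].
Qed.

Lemma provable_weaken (P R : Type) (G D : theory P R) (phi : sentence P R) :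
  Included _ G D -> provable G phi -> provable D phi.
Proof.
  intros Hinc H. revert D Hinc.
  induction H; intros D Hinc;
    eauto using provable.
  - eapply ProvCasesVerbAll; eauto using add_mono.
  - eapply ProvCasesAll; eauto using add_mono.
Qed.

(** Only finitely many assumptions occur in a derivation, so it already lives
    over one member of a directed union. *)
Lemma provable_directed_union (P R : Type) (D : theory P R) (phi : sentence P R) :
  provable D phi ->
  forall (I : Type) (F : I -> theory P R), inhabited I ->
  (forall i j, exists k, Included _ (F i) (F k) /\ Included _ (F j) (F k)) ->
  (forall psi, In _ D psi -> exists i, In _ (F i) psi) ->
  exists i, provable (F i) phi.
Proof.
  (* A cases rule adds its assumption to every member of the family. *)
  assert (Hadd : forall (D : theory P R) (I : Type) (F : I -> theory P R) chi,
    inhabited I ->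
    (forall psi, In _ D psi -> exists i, In _ (F i) psi) ->
    forall psi, In _ (Add _ D chi) psi -> exists i, In _ (Add _ (F i) chi) psi).
  { intros D' I F chi [i0] HF psi [psi' H | psi' H].
    - destruct (HF _ H) as [i Hi]. exists i. left. exact Hi.
    - exists i0. right. exact H. }
  assert (Hdir_add : forall (I : Type) (F : I -> theory P R) chi,
    (forall i j, exists k, Included _ (F i) (F k) /\ Included _ (F j) (F k)) ->
    forall i j, exists k,
      Included _ (Add _ (F i) chi) (Add _ (F k) chi) /\
      Included _ (Add _ (F j) chi) (Add _ (F k) chi)).
  { intros I F chi Hdir i j. destruct (Hdir i j) as [k [Hi Hj]].
    exists k. split; apply add_mono; assumption. }
  induction 1 as
    [ D phi H | D x | D x y z _ IH1 _ IH2 | D r x y _ IH | D x y _ IH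
    | D x y _ IH | D x y z _ IH1 _ IH2 | D r x y _ IH | D r x y _ IH
    | D r x y _ IH | D r x y phi _ IH1 _ IH2 | D x y phi _ IH1 _ IH2 ];
    intros I F HI Hdir HF;
    try (destruct (IH I F HI Hdir HF) as [i Hi]; exists i;
         eauto using provable; fail).
  - destruct (HF _ H) as [i Hi]. exists i. apply ProvAssumption, Hi.
  - destruct HI as [i]. exists i. apply ProvAllRefl.
  - destruct (IH1 I F HI Hdir HF) as [i Hi], (IH2 I F HI Hdir HF) as [j Hj].
    destruct (Hdir i j) as [k [Hik Hjk]]. exists k.
    eapply ProvAllTrans; eauto using provable_weaken.
  - destruct (IH1 I F HI Hdir HF) as [i Hi], (IH2 I F HI Hdir HF) as [j Hj].
    destruct (Hdir i j) as [k [Hik Hjk]]. exists k.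
    eapply ProvExistAll; eauto using provable_weaken.
  - destruct (IH1 I _ HI (Hdir_add _ _ _ Hdir) (Hadd _ _ _ _ HI HF)) as [i Hi].
    destruct (IH2 I _ HI (Hdir_add _ _ _ Hdir) (Hadd _ _ _ _ HI HF)) as [j Hj].
    destruct (Hdir i j) as [k [Hik Hjk]]. exists k.
    eapply ProvCasesVerbAll; eauto using provable_weaken, add_mono.
  - destruct (IH1 I _ HI (Hdir_add _ _ _ Hdir) (Hadd _ _ _ _ HI HF)) as [i Hi].
    destruct (IH2 I _ HI (Hdir_add _ _ _ Hdir) (Hadd _ _ _ _ HI HF)) as [j Hj].
    destruct (Hdir i j) as [k [Hik Hjk]]. exists k.
    eapply ProvCasesAll; eauto using provable_weaken, add_mono.
Qed.

(** [D] does not prove [phi], but every extension of [D] by a sentence that [D]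
    does not prove does. *)
Definition maximal_nonproving (P R : Type) (D : theory P R)
    (phi : sentence P R) : Prop :=
  ~ provable D phi /\
  forall psi, ~ provable D psi -> provable (Add _ D psi) phi.

Lemma maximal_extension (P R : Type) (G : theory P R) (phi : sentence P R) :
  ~ provable G phi ->
  exists D, Included _ G D /\ maximal_nonproving D phi.
Proof.
  intros HG.
  (* Zorn's lemma is applied to the sets of sentences to be added to [G]. The
     index [None] keeps the family [E] inhabited when the chain [F] is empty. *)
  destruct (@classical_sets.Zorn_bigcup (sentence P R)
    (fun A => ~ provable (Union _ G A) phi)) as [A [HA Amax]].
  - intros F HF Ftot Hprov.
    pose (E := fun o : option {B | F B} =>
      match o with
      | None => G
      | Some B => Union _ G (proj1_sig B)
      end).
    destruct (provable_directed_union Hprov E) as [[[B HB] |] Hi].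
    + exact (inhabits None).
    + intros [[B HB] |] [[C HC] |].
      * destruct (Ftot _ _ HB HC) as [HBC | HCB].
        -- exists (Some (exist _ C HC)). split; intros psi H; [|exact H].
           destruct H as [psi H | psi H]; [left; exact H | right; exact (HBC _ H)].
        -- exists (Some (exist _ B HB)). split; intros psi H; [exact H|].
           destruct H as [psi H | psi H]; [left; exact H | right; exact (HCB _ H)].
      * exists (Some (exist _ B HB)).
        split; intros psi H; [exact H | left; exact H].
      * exists (Some (exist _ C HC)).
        split; intros psi H; [left; exact H | exact H].
      * exists None. split; intros psi H; exact H.
    + intros psi [psi' H | psi' [B HB H]].
      * exists None. exact H.
      * exists (Some (exist _ B HB)). right. exact H.
    + exact (HF _ HB Hi).
    + exact (HG Hi).
  - exists (Union _ G A). split; [intros psi H; left; exact H |].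
    split; [exact HA |].
    intros psi Hpsi. apply NNPP. intros Hno.
    apply (Amax (Add _ A psi)).
    + split; [intros chi H; left; exact H |].
      intros Hsub. apply Hpsi, ProvAssumption. right.
      apply Hsub. right. constructor.
    + intros H. apply Hno. revert H. apply provable_weaken.
      intros chi [chi' H | chi' [chi'' H | chi'' H]].
      * left. left. exact H.
      * left. right. exact H.
      * right. exact H.
Qed.

(** [D] decides every term: a term not provably nonempty behaves in [D] as an
    empty one. *)
Definition decides_emptiness (P R : Type) (D : theory P R) : Prop :=
  forall x, provable D (Exist x x) \/
    (forall y, provable D (All x y)) /\
    (forall r y, provable D (All y (VerbAll r x))).

Lemma maximal_decides_emptiness (P R : Type) (D : theory P R)
    (phi : sentence P R) :
  maximal_nonproving D phi -> decides_emptiness D.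
Proof.
  intros [HD Hmax] x.
  destruct (classic (provable D (Exist x x))) as [Hx | Hx]; [left; exact Hx |].
  right. split.
  - intros y. apply NNPP. intros Hy. apply HD.
    exact (ProvCasesAll (Hmax _ Hx) (Hmax _ Hy)).
  - intros r y. apply NNPP. intros Hy. apply HD.
    exact (ProvCasesVerbAll (Hmax _ Hx) (Hmax _ Hy)).
Qed.

(** * The canonical model *)

(** A pair of terms that [D] proves to have a common element; the boolean
    distinguishes two copies of the pair. *)
Record point (P R : Type) (D : theory P R) : Type := Point {
  pt_left : term P R;
  pt_right : term P R;
  pt_marked : bool;
  pt_exist : provable D (Exist pt_left pt_right)
}.

(** The terms to which a point belongs in the canonical model. *)
Definition below (P R : Type) (D : theory P R) (m : point D) (z : term P R) :
    Prop :=
  provable D (All (pt_left m) z) \/ provable D (All (pt_right m) z).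

(** The marked copy of the pair [w], [w] is the successor chosen for the points
    below [VerbSome r w]. *)
Definition canonical_model (P R : Type) (D : theory P R) : model P R :=
  {| domain := point D;
     noun_interp := fun p m => below m (Noun R p);
     verb_interp := fun r m n =>
       (exists u, below m (VerbAll r u) /\ below n u) \/
       (exists w, below m (VerbSome r w) /\
          pt_left n = w /\ pt_right n = w /\ pt_marked n = true) |}.

Lemma below_trans (P R : Type) (D : theory P R) (m : point D) (x y : term P R) :
  below m x -> provable D (All x y) -> below m y.
Proof.
  intros [H | H] Hxy; [left | right]; exact (ProvAllTrans H Hxy).
Qed.

Lemma below_exist (P R : Type) (D : theory P R) (m : point D) (x y : term P R) :
  below m x -> below m y -> provable D (Exist x y).
Proof.
  destruct m as [a b c Hab]. unfold below; simpl.
  (* [a] and [b] are provably nonempty, and provably meet in either order. *)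
  assert (Hba := ProvExistSym Hab).
  assert (Haa := ProvExistRefl Hab).
  assert (Hbb := ProvExistRefl Hba).
  intros [Hx | Hx] [Hy | Hy];
    eauto using ProvExistAll, ProvExistSym.
Qed.

(** Emptiness has to be decided only for [VerbAll r v]: if [v] is not provably
    nonempty, every term is provably below [VerbAll r v]; otherwise the pair
    [v], [v] is a point. *)
Lemma canonical_truth (P R : Type) (D : theory P R) (z : term P R) :
  decides_emptiness D ->
  forall m : point D, In _ (interp (canonical_model D) z) m <-> below m z.
Proof.
  intros Hdec.
  induction z as [p | r v IH | r v IH]; intros m.
  - reflexivity.
  - split.
    + intros H. destruct (Hdec v) as [Hv | [_ Hv]].
      * (* The unmarked copy of the pair [v], [v] is a successor of [m]. *)
        destruct (H (Point false Hv)) as [[u [Hm Hu]] | [w [_ [_ [_ Hf]]]]].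
        -- apply IH. left. apply ProvAllRefl.
        -- apply (below_trans Hm), ProvVerbAllAnti.
           destruct Hu; assumption.
        -- discriminate Hf.
      * left. apply Hv.
    + intros H n Hn. left. exists v. split; [exact H | apply IH, Hn].
  - split.
    + intros [n [Hn [[u [Hm Hu]] | [w [Hm [Hl [Hr _]]]]]]]; apply IH in Hn.
      * exact (below_trans Hm (ProvVerbAllSome r (below_exist Hu Hn))).
      * apply (below_trans Hm), ProvVerbSomeMono.
        unfold below in Hn. rewrite Hl, Hr in Hn. destruct Hn; assumption.
    + intros H.
      assert (Hv := ProvVerbSomeExist (below_exist H H)).
      exists (Point true Hv). split.
      * apply IH. left. apply ProvAllRefl.
      * right. exists v. repeat split. exact H.
Qed.

Lemma canonical_satisfies (P R : Type) (D : theory P R) (psi : sentence P R) :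
  decides_emptiness D ->
  satisfies (canonical_model D) psi <-> provable D psi.
Proof.
  intros Hdec. destruct psi as [x y | x y]; split.
  - intros H. destruct (Hdec x) as [Hx | [Hx _]]; [| apply Hx].
    assert (Hy : below (Point false Hx) y).
    { apply canonical_truth; [exact Hdec |]. apply H.
      apply canonical_truth; [exact Hdec |]. left. apply ProvAllRefl. }
    destruct Hy; assumption.
  - intros H m Hm. apply canonical_truth; [exact Hdec |].
    apply canonical_truth in Hm; [| exact Hdec]. exact (below_trans Hm H).
  - intros [m [m' Hx Hy]].
    apply canonical_truth in Hx; [| exact Hdec].
    apply canonical_truth in Hy; [| exact Hdec].
    exact (below_exist Hx Hy).
  - intros H. exists (Point false H).
    split; apply canonical_truth; try exact Hdec.
    + left. apply ProvAllRefl.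
    + right. apply ProvAllRefl.
Qed.

Theorem theorem3p5 (P R : Type) (Gamma : theory P R) (phi : sentence P R) :
  entails Gamma phi <-> provable Gamma phi.
Proof.
  split; [| apply soundness].
  intros Hent. apply NNPP. intros Hno.
  destruct (maximal_extension Hno) as [D [Hinc Hmax]].
  assert (Hdec := maximal_decides_emptiness Hmax).
  apply (proj1 Hmax), (canonical_satisfies _ Hdec), Hent.
  intros psi Hpsi. apply (canonical_satisfies _ Hdec), ProvAssumption, Hinc, Hpsi.
Qed.
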